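(* Let $\Phi_1$ and $\Phi_2$ be two $\mathcal{C}^1$ convex growth functions with $\Phi_2\in\mathscr{U}$. Assume that $\Phi_1$ satisfies the $\nabla_2$-condition and that $\frac{\Phi_2}{\Phi_1}$ is nondecreasing. Let $\mu$ be a positive Borel measure on $\mathbb{C}_+$. Then the following assertions are equivalent. (a) There exists a constant $C_1>0$ such that for any interval $I\subset \mathbb{R}$, $\mu(Q_I)\le \dfrac{C_1}{\Phi_2\circ\Phi_1^{-1}\left(\frac{1}{|I|}\right)}$. (b) There exists a constant $C_2>0$ such that for any $f\in H^{\Phi_1}(\mathbb{C}_+)$, $f\neq 0$, $$\sup_{\lambda>0}\Phi_2(\lambda)\,\mu\left(\left\{z\in \mathbb{C}_+:\,|f(z)|>C_2\lambda\|f^\star\|_{L^{\Phi_1}}^{lux} \right\}\right)\le 1.$$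
   Context: $\mathbb{C}_+=\{x+iy: y>0\}$. A growth function is a continuous nondecreasing function from $[0,\infty)$ onto $[0,\infty)$; $\Phi^{-1}$ is its inverse. $\mathscr{U}^q$ ($q\ge1$) is the set of growth functions $\Phi$ with $\Phi(st)\le Ct^q\Phi(s)$ for $s>0,t\ge1$ and $t\mapsto\Phi(t)/t$ nondecreasing; $\mathscr{U}=\bigcup_{q\ge1}\mathscr{U}^q$. A convex growth function satisfies the $\nabla_2$-condition if both it and its complementary function $\Psi(s)=\sup_{t\ge0}\{ts-\Phi(t)\}$ satisfy $F(2t)\le KF(t)$ for some $K>1$, all $t\ge0$. $Q_I=\{x+iy:x\in I,0<y<|I|\}$. $\|g\|_{L^\Phi}^{lux}=\inf\{\lambda>0:\int_{\mathbb{R}}\Phi(|g|/\lambda)dx\le1\}$; $H^\Phi(\mathbb{C}_+)$: holomorphic $f$ with $\sup_{y>0}\|f(\cdot+iy)\|^{lux}_{L^\Phi}<\infty$. $f^\star(x)=\sup\{|f(t+iy)|: |t-x|<y\}$ is the nontangential maximal function. *)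

(* Defs.v *)
From HB Require Import structures.
From mathcomp Require Import all_boot all_order all_algebra.
From mathcomp Require Import all_classical all_reals all_analysis.
From mathcomp Require Import complex.
Set Implicit Arguments. Unset Strict Implicit. Unset Printing Implicit Defensive.
Import Order.TTheory GRing.Theory Num.Theory.
Import numFieldNormedType.Exports.
Local Open Scope ring_scope.
Local Open Scope classical_set_scope.

Section Defs.
Variable R : realType.

Definition growth_function (Phi : R -> R) : Prop :=
  {within `[0, +oo[, continuous Phi} /\
  {in `[0, +oo[ &, {homo Phi : x y / x <= y}} /\
  Phi @` `[0, +oo[ = `[0, +oo[.

Definition convex_nonneg (Phi : R -> R) : Prop :=
  forall x y a, 0 <= x -> 0 <= y -> 0 <= a <= 1 ->
    Phi ((1 - a) * x + a * y) <= (1 - a) * Phi x + a * Phi y.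

Definition C1_nonneg (Phi : R -> R) : Prop :=
  exists dPhi : R -> R, {within `[0, +oo[, continuous dPhi} /\
    forall t, 0 <= t ->
      (fun h => h^-1 * (Phi (t + h) - Phi t))
        @ within [set h : R | 0 <= t + h /\ h != 0] (nbhs (0 : R)) --> dPhi t.

(* inverse of a growth function: Phi^{-1}(s) = sup {t >= 0 | Phi t <= s}
   (the unique preimage of s > 0 for the convex growth functions considered) *)
Definition ginv (Phi : R -> R) (s : R) : R :=
  sup [set t : R | 0 <= t /\ Phi t <= s].

Definition in_Uq (q : R) (Phi : R -> R) : Prop :=
  growth_function Phi /\
  (exists C : R, 0 < C /\ forall s t, 0 < s -> 1 <= t ->
      Phi (s * t) <= C * t `^ q * Phi s) /\
  {in `]0, +oo[ &, {homo (fun t => Phi t / t) : x y / x <= y}}.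

Definition in_U (Phi : R -> R) : Prop := exists q : R, 1 <= q /\ in_Uq q Phi.

Definition compl_fun (Phi : R -> R) (s : R) : \bar R :=
  ereal_sup [set (t * s - Phi t)%:E | t in `[0, +oo[].

Definition Delta2 (F : R -> R) : Prop :=
  exists K : R, 1 < K /\ forall t, 0 <= t -> F (2 * t) <= K * F t.

Definition Delta2e (F : R -> \bar R) : Prop :=
  exists K : R, 1 < K /\ forall t : R, 0 <= t -> (F (2 * t)%R <= K%:E * F t)%E.

Definition nabla2 (Phi : R -> R) : Prop := Delta2 Phi /\ Delta2e (compl_fun Phi).

Definition cre (z : R[i]) : R := let: Complex a _ := z in a.
Definition cim (z : R[i]) : R := let: Complex _ b := z in b.
Definition cmod (z : R[i]) : R := Num.sqrt (cre z ^+ 2 + cim z ^+ 2).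

(* holomorphic on C_+ : complex differentiable at every point of C_+ *)
Definition holomorphic_upper (f : R[i] -> R[i]) : Prop :=
  forall z : R[i], 0 < cim z -> derivable (f : R[i]^o -> R[i]^o) z 1.

Definition ePhi (Phi : R -> R) (x : \bar R) : \bar R :=
  match x with
  | r%:E => (Phi r)%:E
  | +oo%E => +oo%E
  | -oo%E => 0%E
  end.

Definition luxnorm (Phi : R -> R) (g : R -> \bar R) : \bar R :=
  ereal_inf [set l%:E | l in [set l : R | 0 < l /\
     (\int[lebesgue_measure]_x ePhi Phi (g x * (l^-1)%:E) <= 1)%E]].

Definition hardy_orlicz (Phi : R -> R) (f : R[i] -> R[i]) : Prop :=
  holomorphic_upper f /\
  exists M : R, forall y : R, 0 < y ->
    (luxnorm Phi (fun x => (cmod (f (Complex x y)))%:E) <= M%:E)%E.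

Definition ntmax (f : R[i] -> R[i]) (x : R) : \bar R :=
  ereal_sup [set (cmod (f (Complex p.1 p.2)))%:E
            | p in [set p : R * R | `|p.1 - x| < p.2]].

(* Carleson box Q_I = {x + iy : x in I, 0 < y < |I|}, with l = |I|;
   points x + iy of C are represented by pairs (x, y) in R * R *)
Definition Qbox (I : set R) (l : R) : set (R * R) :=
  [set p : R * R | I p.1 /\ 0 < p.2 < l].

End Defs.

(* Main.v *)
(** If [s < |f(x + iy)|] then [f^* > s] on the whole base [(x - y, x + y)] of the
    tent at [x + iy], so [{|f| > s}] lies in the Carleson boxes over the
    components of the open set [{f^* > s}].  Chebyshev's inequality bounds the
    length of that set by [1 / Phi1 v], hence the length of every component, and
    since [Phi2 / Phi1] is nondecreasing the Carleson bound for a component of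
    length [m] is at most [m * C1 * Phi1 v / Phi2 v]; these bounds add up.
    Conversely, for [I] with left endpoint [a] and length [L], the function
    [u (L / (z - a + i L)) ^ 2] with [u = Phi1^-1 (1 / L)] has modulus at least
    [u / 5] on [Q_I], while [f^* <= 2 u / (1 + ((x - a) / L) ^ 2)], whose
    Luxemburg norm is at most [2 pi] by convexity. *)
Require Import Defs.
From HB Require Import structures.
From mathcomp Require Import all_boot all_order all_algebra.
From mathcomp Require Import all_classical all_reals all_analysis.
From mathcomp Require Import measurable_realfun complex.
From mathcomp Require Import ring lra.
Set Implicit Arguments. Unset Strict Implicit. Unset Printing Implicit Defensive.
Import Order.TTheory GRing.Theory Num.Theory.
Import numFieldNormedType.Exports.
Local Open Scope ring_scope.
Local Open Scope classical_set_scope.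

(** * Growth functions: positivity, strict monotonicity, inverse *)

Lemma growth_ge0 (R : realType) (Phi : R -> R) (t : R) :
  growth_function Phi -> 0 <= t -> 0 <= Phi t.
Proof.
move=> [_ [_ Phi_onto]] t0.
have : (Phi @` `[0, +oo[) (Phi t) by exists t => //=; rewrite in_itv/= t0.
by rewrite Phi_onto /= in_itv/= andbT.
Qed.

Lemma growth_le (R : realType) (Phi : R -> R) (x y : R) :
  growth_function Phi -> 0 <= x -> x <= y -> Phi x <= Phi y.
Proof.
move=> [_ [Phi_nd _]] x0 xy; apply: Phi_nd => //; rewrite inE/= in_itv/= andbT //.
exact: le_trans xy.
Qed.

Lemma growth_onto (R : realType) (Phi : R -> R) (s : R) :
  growth_function Phi -> 0 <= s -> exists2 t, 0 <= t & Phi t = s.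
Proof.
move=> [_ [_ Phi_onto]] s0.
have : (`[0, +oo[%classic : set R) s by rewrite /= in_itv/= s0.
by rewrite -Phi_onto => -[t /=]; rewrite in_itv/= andbT => t0 <-; exists t.
Qed.

Lemma growth0 (R : realType) (Phi : R -> R) : growth_function Phi -> Phi 0 = 0.
Proof.
move=> gPhi; have [t t0 Phit] := @growth_onto _ _ 0 gPhi (lexx _).
apply/eqP; rewrite eq_le growth_ge0// andbT -[leRHS]Phit.
exact: growth_le.
Qed.

(** A zero at [t > 0] would spread by doubling to every [2 ^+ n * t], hence by monotonicity to all
    of the half-line, yet [Phi] takes the value 1. *)
Lemma Delta2_gt0 (R : realType) (Phi : R -> R) (t : R) :
  growth_function Phi -> Delta2 Phi -> 0 < t -> 0 < Phi t.
Proof.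
move=> gPhi [K [K1 PhiK]] t0; rewrite lt_neqAle growth_ge0 ?(ltW t0)// andbT.
apply/eqP => /esym Phit0.
have Phi2n n : Phi (2 ^+ n * t) = 0.
  elim: n => [|n IHn]; first by rewrite expr0 mul1r.
  apply/eqP; rewrite eq_le growth_ge0 ?mulr_ge0 ?(ltW t0)// andbT.
  by rewrite exprS -mulrA (le_trans (PhiK _ _)) ?IHn ?mulr0// mulr_ge0// ltW.
have [x x0 Phix] := @growth_onto _ _ 1 gPhi ler01.
have xt : x <= 2 ^+ (Num.truncn (x / t)).+1 * t.
  rewrite -ler_pdivrMr// (le_trans (ltW (truncnS_gt _)))//.
  by rewrite -natrX ler_nat ltnW// ltn_expl.
have := growth_le gPhi x0 xt.
by rewrite Phix Phi2n ler10.
Qed.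

(** The bound on [Phi (t * a)] would carry a zero at [t] to all larger points, yet [Phi] takes the
    value 1. *)
Lemma Uq_gt0 (R : realType) (q : R) (Phi : R -> R) (t : R) :
  in_Uq q Phi -> 0 < t -> 0 < Phi t.
Proof.
move=> [gPhi [[C [C0 PhiC]] _]] t0.
rewrite lt_neqAle growth_ge0 ?(ltW t0)// andbT; apply/eqP => /esym Phit0.
have [x x0 Phix] := @growth_onto _ _ 1 gPhi ler01.
pose a := Num.max 1 (x / t).
have a1 : 1 <= a by rewrite le_max lexx.
have xa : x <= t * a by rewrite mulrC -ler_pdivrMr// le_max lexx orbT.
have := le_trans (growth_le gPhi x0 xa) (PhiC _ _ t0 a1).
by rewrite Phix Phit0 mulr0 ler10.
Qed.

Section convex_growth.
Variables (R : realType) (Phi : R -> R).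
Hypotheses (gPhi : growth_function Phi) (cPhi : convex_nonneg Phi).

Lemma convex_growth_contract (a x : R) : 0 <= a <= 1 -> 0 <= x ->
  Phi (a * x) <= a * Phi x.
Proof.
move=> a01 x0; have := cPhi (lexx 0) x0 a01.
by rewrite (growth0 gPhi) !mulr0 !add0r.
Qed.

Hypothesis Phi_gt0 : forall t, 0 < t -> 0 < Phi t.

(** Convexity and [Phi 0 = 0] give [Phi x <= (x / y) * Phi y], and [x / y < 1]. *)
Lemma convex_growth_lt (x y : R) : 0 <= x -> x < y -> Phi x < Phi y.
Proof.
move=> x0 xy; have y0 : 0 < y by exact: le_lt_trans xy.
have /convex_growth_contract -/(_ _ (ltW y0)) : 0 <= x / y <= 1.
  by rewrite divr_ge0 ?(ltW y0)//= ler_pdivrMr// mul1r ltW.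
rewrite divfK ?gt_eqF// => /le_lt_trans; apply.
by rewrite gtr_pMl ?Phi_gt0// ltr_pdivrMr// mul1r.
Qed.

Lemma convex_growth_le_reflect (x y : R) : 0 <= x -> 0 <= y ->
  Phi x <= Phi y -> x <= y.
Proof.
move=> x0 y0; rewrite leNgt [in X in _ -> X]leNgt.
by apply: contra => /convex_growth_lt; exact.
Qed.

(** By strict monotonicity the supremum defining [ginv] is attained at the preimage of [s], so
    [ginv] is the true inverse. *)
Lemma ginvP (s : R) : 0 < s -> 0 < ginv Phi s /\ Phi (ginv Phi s) = s.
Proof.
move=> s0; have [t t0 Phit] := growth_onto gPhi (ltW s0).
have -> : ginv Phi s = t.
  apply/eqP; rewrite eq_le; apply/andP; split.
    apply: ge_sup; first by exists t; split=> //; rewrite Phit.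
    by move=> x [x0 Phix]; apply: convex_growth_le_reflect => //; rewrite Phit.
  apply: ub_le_sup; last by split=> //; rewrite Phit.
  exists t => x [x0 Phix].
  by apply: convex_growth_le_reflect => //; rewrite Phit.
split=> //; rewrite lt_neqAle t0 andbT; apply: contra_ltN s0 => /eqP t00.
by rewrite -Phit -t00 (growth0 gPhi).
Qed.

End convex_growth.

(** * Integration and measurability tools *)

(** The integral of a nonnegative function is a supremum over simple functions below it, which is
    monotone as such. This spares a measurability proof for [Phi] composed with [ntmax f]. *)
Lemma le_ge0_integral_nonmeasurable d (T : measurableType d) (R : realType)
    (mu : {measure set T -> \bar R}) (f g : T -> \bar R) :
  (forall x, 0 <= f x)%E -> (forall x, f x <= g x)%E ->
  (\int[mu]_x f x <= \int[mu]_x g x)%E.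
Proof.
move=> f0 fg; have g0 x : (0 <= g x)%E by exact: le_trans (fg x).
rewrite !ge0_integralTE//; apply: ereal_sup_le => _ [h hf <-].
by exists h => // x; exact: le_trans (fg x).
Qed.

Lemma open_measurable_prod (R : realType) (U : set (R * R)) :
  open U -> measurable U.
Proof.
move=> oU.
(* Open squares with rational centre and half-side form a countable base; each is a measurable
   rectangle. *)
pose B (q : rat * rat * rat) : set (R * R) :=
  `]ratr q.1.1 - ratr q.2, ratr q.1.1 + ratr q.2[ `*`
  `]ratr q.1.2 - ratr q.2, ratr q.1.2 + ratr q.2[.
have -> : U = \bigcup_q (if `[< B q `<=` U >] then B q else set0).
  apply/seteqP; split => [[x y] Uxy|p [q _]]; last by case: ifPn => // /asboolP; exact.
  have : nbhs (x, y) U by exact: open_nbhs_nbhs.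
  move=> /nbhs_ballP[e /= e0 exyU].
  (* A square of half-side [r] centred within [r] of the point contains it and stays within
     [2 * r < e] of it. *)
  have [r] : exists r : rat, (ratr r : R) \in `]0, e / 2[%R.
    by apply: (@rat_in_itvoo R); rewrite divr_gt0.
  rewrite in_itv/= => /andP[r0 re].
  have near_rat (z : R) : exists2 q : rat, z - ratr r < ratr q & ratr q < z + ratr r.
    have [q] : exists q : rat, (ratr q : R) \in `]z - ratr r, z + ratr r[%R.
      by apply: (@rat_in_itvoo R); lra.
    by rewrite in_itv/= => /andP[? ?]; exists q.
  have [qx xqx qxx] := near_rat x; have [qy yqy qyy] := near_rat y.
  exists (qx, qy, r) => //; case: ifPn => [_|/asboolPn[]].
    by split; rewrite /= in_itv/=; apply/andP; split; lra.
  move=> [a b] [/=]; rewrite !in_itv/= => /andP[? ?] /andP[? ?].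
  apply: exyU; split; rewrite /ball/= ltr_norml; apply/andP; split; lra.
apply: countable_bigcupT_measurable => //.
move=> q; case: ifPn => // _; apply: measurableX; exact: measurable_itv.
Qed.

Lemma measurable_Qbox (R : realType) (I : set R) (l : R) :
  measurable I -> measurable (Qbox I l).
Proof.
move=> mI; have -> : Qbox I l = I `*` `]0, l[.
  by apply/seteqP; split => p; rewrite /Qbox /= in_itv.
by apply: measurableX => //; exact: measurable_itv.
Qed.

(** * Intervals, components of open sets, tents *)

Lemma itv_lty_measure (R : realType) (I : set R) : is_interval I ->
  (lebesgue_measure I < +oo)%E ->
  lebesgue_measure I = 0%E \/
  exists a b : R, [/\ a < b, `]a, b[ `<=` I, I `<=` `[a, b] &
    lebesgue_measure I = (b - a)%:E].
Proof.
move=> /is_intervalP ->; case: (Rhull I) => -[ba a|[|]] [bb b|[|]];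
  rewrite lebesgue_measure_itv//=; rewrite ?lte_fin ?ltNyr ?ltry//=; try by left.
case: ifPn => ab _; last by left.
right; exists a, b; split => //.
- move=> x /=; rewrite !in_itv/= => /andP[ax xb].
  by apply/andP; split; [case: (ba)|case: (bb)] => //=; exact: ltW.
- move=> x /=; rewrite !in_itv/= => /andP[ax xb]; apply/andP; split.
    by move: ax; case: (ba) => //=; exact: ltW.
  by move: xb; case: (bb) => //=; exact: ltW.
Qed.

(** The trace of [I n] on [B] is open, and also closed because the other [I k] cover the rest of
    [B]. *)
Lemma connected_in_component (R : realType) (I : nat -> set R) (B : set R) n :
  (forall k, open (I k)) -> trivIset setT I -> connected B ->
  B `<=` \bigcup_k I k -> B `&` I n !=set0 -> B `<=` I n.
Proof.
move=> oI tI cB BI BIn0; suff <- : B `&` I n = B by exact: subIsetr.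
apply: cB => //; first by exists (I n).
exists (~` \bigcup_(k in [set k | k != n]) I k).
  by apply: open_closedC; apply: bigcup_open.
apply/seteqP; split => [x [Bx Inx]|x [Bx nIx]]; split => //.
  move=> [k /= kn Ikx].
  by move/trivIsetP : tI => /(_ k n Logic.I Logic.I kn); rewrite -subset0 => /(_ x); exact.
have [k _ Ikx] := BI _ Bx; have [<-//|kn] := eqVneq k n.
by exfalso; apply: nIx; exists k.
Qed.

(* The boxes over the components of E cover S: the base of the tent below a
   point of S is connected, so it lies in a single component. *)
Lemma measure_tents_le (R : realType)
    (mu : {measure set (R * R)%type -> \bar R}) (K : R) (E : set R)
    (S : set (R * R)) :
  0 <= K -> open E -> (lebesgue_measure E < +oo)%E ->
  (forall (a b : R) (I : set R), a < b -> `]a, b[ `<=` I -> I `<=` `[a, b] ->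
     ((b - a)%:E <= lebesgue_measure E)%E ->
     (mu (Qbox I (b - a)) <= (K * (b - a))%:E)%E) ->
  measurable S ->
  (forall p, S p -> 0 < p.2 /\ `]p.1 - p.2, p.1 + p.2[ `<=` E) ->
  (mu S <= K%:E * lebesgue_measure E)%E.
Proof.
move=> K0 oE Efin muQ mS tentS.
pose I := open_disjoint_itv oE.
have oI k : open (I k) by exact: open_disjoint_itv_open.
have itvI k : is_interval (I k) by exact: open_disjoint_itv_is_interval.
have mI k : measurable (I k) by exact: open_measurable.
have tI : trivIset setT I by exact: open_disjoint_itv_trivIset.
have EI : E = \bigcup_k I k by exact: open_disjoint_itv_bigcup.
have mE : measurable E by exact: open_measurable.
have IE k : (lebesgue_measure (I k) <= lebesgue_measure E)%E.
  apply: le_measure; rewrite ?inE; [exact: mI|exact: mE|].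
  by rewrite EI; exact: bigcup_sup.
have Ifin k : (lebesgue_measure (I k) < +oo)%E by exact: le_lt_trans Efin.
pose Q k := Qbox (I k) (fine (lebesgue_measure (I k))).
have mQ k : measurable (Q k) by exact: measurable_Qbox.
have SQ : S `<=` \bigcup_k Q k.
  move=> p Sp; have [p20 pE] := tentS _ Sp.
  have pp : (`]p.1 - p.2, p.1 + p.2[%classic : set R) p.1.
    by rewrite /= in_itv/= ltrBlDr ltrDl p20.
  have : (\bigcup_k I k) p.1 by rewrite -EI; exact: pE.
  move=> [n _ Inp]; exists n => //; split => //; rewrite p20/=.
  have pIn : `]p.1 - p.2, p.1 + p.2[ `<=` I n.
    apply: (connected_in_component oI tI); last by exists p.1.
      by apply/connected_intervalP; exact: interval_is_interval.
    by rewrite -EI.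
  (* The base of the tent has length [2 * p.2] and lies in [I n], so the height [p.2] is below the
     height of the box. *)
  rewrite -lte_fin fineK ?ge0_fin_numE//.
  have : (lebesgue_measure (`](p.1 - p.2)%R, (p.1 + p.2)%R[%classic : set R)
           <= lebesgue_measure (I n))%E.
    by apply: le_measure; rewrite ?inE//; exact: mI.
  apply: lt_le_trans; rewrite lebesgue_measure_itv/= lte_fin.
  have -> : p.1 - p.2 < p.1 + p.2 by lra.
  by rewrite -EFinD lte_fin; lra.
have muQk k : (mu (Q k) <= K%:E * lebesgue_measure (I k))%E.
  have [I0|[a [b [ab abI Iab mIab]]]] :=
      itv_lty_measure (itvI k) (Ifin k).
    (* A component of length 0 carries a box of height 0, which is empty. *)
    rewrite /Q [lebesgue_measure (I k)]I0 mule0.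
    suff -> : Qbox (I k) (fine 0%E) = set0 by rewrite measure0.
    by rewrite -subset0 => p [_ /= /andP[/lt_trans h /h]]; rewrite ltxx.
  rewrite /Q [lebesgue_measure (I k)]mIab -EFinM; apply: muQ => //.
  by rewrite -mIab; exact: IE.
apply: (@le_trans _ _ (\sum_(k <oo) mu (Q k))%E).
  exact: measure_sigma_subadditive.
apply: (@le_trans _ _ (\sum_(k <oo) (K%:E * lebesgue_measure (I k)))%E).
  by apply: lee_nneseries => // k _; exact: muQk.
rewrite nneseriesZl//.
suff -> : lebesgue_measure E = (\sum_(k <oo) lebesgue_measure (I k))%E by [].
by rewrite {1}EI measure_semi_bigcup// -EI.
Qed.

(** * The nontangential maximal function and the Luxemburg norm *)

(** A point [(t, y)] of the cone at [x] stays in the cones at all points closer to [x] than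
    [y - |t - x|]. *)
Lemma open_ntmax_gt (R : realType) (f : R[i] -> R[i]) (s : R) :
  open [set x | (s%:E < ntmax f x)%E].
Proof.
rewrite openE => x /= /ereal_sup_gt[_ [[t y] /= txy <-] sf].
rewrite /interior -nbhs_ballE; exists (y - `|t - x|); first by rewrite /= subr_gt0.
move=> z /= xz; rewrite /ball/= in xz.
apply: (lt_le_trans sf); apply: ereal_sup_ubound; exists (t, y) => //=.
have -> : t - z = (t - x) + (x - z) by ring.
by rewrite (le_lt_trans (ler_normD _ _))// -ltrBrDl.
Qed.

Lemma ntmax_ge0 (R : realType) (f : R[i] -> R[i]) (x : R) : (0 <= ntmax f x)%E.
Proof.
apply: le_ereal_sup_tmp; exists (cmod (f (Complex x 1)))%:E.
  by exists (x, 1) => //=; rewrite subrr normr0.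
by rewrite lee_fin sqrtr_ge0.
Qed.

Lemma le_ntmax (R : realType) (f : R[i] -> R[i]) (x t y : R) :
  `|t - x| < y -> ((cmod (f (Complex t y)))%:E <= ntmax f x)%E.
Proof. by move=> txy; apply: ereal_sup_ubound; exists (t, y). Qed.

Section luxemburg.
Variables (R : realType) (Phi : R -> R).
Hypothesis gPhi : growth_function Phi.

Lemma ePhi_ge0 (x : \bar R) : (0 <= x)%E -> (0 <= ePhi Phi x)%E.
Proof. by case: x => [r| |]//=; rewrite !lee_fin; exact: growth_ge0. Qed.

Lemma le_ePhi (x y : \bar R) : (0 <= x)%E -> (x <= y)%E ->
  (ePhi Phi x <= ePhi Phi y)%E.
Proof.
case: x y => [r| |] [s| |]//=; rewrite ?leey// !lee_fin; exact: growth_le.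
Qed.

(** The integrand dominates the constant [Phi (s / l)] on [E], extended by 0. *)
Lemma modular_chebyshev (F : R -> \bar R) (E : set R) (s l : R) :
  measurable E -> 0 <= s -> 0 < l -> (forall x, 0 <= F x)%E ->
  (forall x, E x -> s%:E <= F x)%E ->
  (\int[lebesgue_measure]_x ePhi Phi (F x * (l^-1)%:E) <= 1)%E ->
  ((Phi (s / l))%:E * lebesgue_measure E <= 1)%E.
Proof.
move=> mE s0 l0 F0 sF; apply: le_trans.
have li0 : (0 <= (l^-1)%:E)%E by rewrite lee_fin invr_ge0 ltW.
rewrite -(integral_cst lebesgue_measure mE) integral_mkcond.
apply: le_ge0_integral_nonmeasurable => x.
  rewrite patchE; case: ifPn => // _.
  by rewrite lee_fin growth_ge0// divr_ge0// ltW.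
rewrite patchE; case: ifPn => [|_]; last by rewrite ePhi_ge0// mule_ge0.
rewrite inE => Ex.
rewrite (_ : cst _ x = ePhi Phi (s%:E * (l^-1)%:E))//; apply: le_ePhi.
  by rewrite mule_ge0// lee_fin.
by rewrite lee_wpmul2r// sF.
Qed.

Lemma luxnorm_le (F : R -> \bar R) (l : R) : 0 < l ->
  (\int[lebesgue_measure]_x ePhi Phi (F x * (l^-1)%:E) <= 1)%E ->
  (luxnorm Phi F <= l%:E)%E.
Proof. by move=> l0 Fl; apply: ereal_inf_lbound; exists l. Qed.

Lemma luxnorm_ltP (F : R -> \bar R) (m : \bar R) : (luxnorm Phi F < m)%E ->
  exists l : R, [/\ 0 < l, (l%:E < m)%E &
    (\int[lebesgue_measure]_x ePhi Phi (F x * (l^-1)%:E) <= 1)%E].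
Proof. by move=> /ereal_inf_lt[_ [l [l0 Fl] <-] lm]; exists l. Qed.

Lemma luxnorm_gt0 (F : R -> \bar R) (a b s : R) : a < b -> 0 < s ->
  (forall x, 0 <= F x)%E -> (forall x, `]a, b[%classic x -> s%:E <= F x)%E ->
  (0 < luxnorm Phi F)%E.
Proof.
move=> ab s0 F0 sF.
have ba : 0 < b - a by rewrite subr_gt0.
(* An admissible [l < s / t] would give [Phi t * (b - a) <= 1] by Chebyshev, whereas this product is
   2. Hence the norm is at least [s / t]. *)
have [t t0 Phit] := @growth_onto _ _ (2 / (b - a)) gPhi (divr_ge0 (ler0n _ _) (ltW ba)).
have {}t0 : 0 < t.
  rewrite lt_neqAle t0 andbT; apply/eqP => t00.
  have : 0 < 2 / (b - a) by rewrite divr_gt0.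
  by rewrite -Phit -t00 growth0// ltxx.
apply: (@lt_le_trans _ _ (s / t)%:E); first by rewrite lte_fin divr_gt0.
apply: le_ereal_inf_tmp => _ [l [l0 Fl] <-]; rewrite lee_fin leNgt.
apply/negP => lst.
have := modular_chebyshev (@measurable_itv _ _) (ltW s0) l0 F0 sF Fl.
rewrite lebesgue_measure_itv/= lte_fin ab -EFinD -EFinM lee_fin.
have : Phi t <= Phi (s / l).
  by apply: growth_le => //; [exact: ltW|rewrite ler_pdivlMr// mulrC -ler_pdivlMr// ltW].
rewrite Phit ler_pdivrMr// => h /(le_trans h); by rewrite (ler_nat R 2 1).
Qed.

End luxemburg.

(** * The complex modulus and level sets of holomorphic functions *)

Lemma normc_cmod (R : realType) (z : R[i]) : `|z| = (cmod z)%:C%C.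
Proof. by case: z => a b; rewrite normc_def. Qed.

Lemma cmodM (R : realType) (z w : R[i]) : cmod (z * w) = cmod z * cmod w.
Proof.
have : `|z * w| = `|z| * `|w| by rewrite normrM.
by rewrite !normc_cmod -rmorphM/= => -[].
Qed.

Lemma cmodV (R : realType) (z : R[i]) : cmod z^-1 = (cmod z)^-1.
Proof.
have : `|z^-1| = `|z|^-1 by rewrite normfV.
by rewrite !normc_cmod -fmorphV/= => -[].
Qed.

Lemma cmodB_ge (R : realType) (z w : R[i]) : cmod z - cmod w <= cmod (z - w).
Proof.
have : `|z| - `|w| <= `|z - w| by exact: lerB_dist.
by rewrite !normc_cmod -rmorphB/= lecR.
Qed.

Lemma cmod_real (R : realType) (r : R) : 0 <= r -> cmod r%:C%C = r.
Proof. by move=> r0; rewrite /cmod/= expr0n addr0 sqrtr_sqr ger0_norm. Qed.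

Lemma cmod_le (R : realType) (z : R[i]) : cmod z <= `|cre z| + `|cim z|.
Proof.
rewrite /cmod -[leRHS]ger0_norm ?addr_ge0// -sqrtr_sqr ler_wsqrtr//.
rewrite sqrrD !real_normK ?num_real// -addrA lerD2l lerDr.
by rewrite mulrn_wge0// mulr_ge0.
Qed.

Lemma holomorphic_open_level (R : realType) (f : R[i] -> R[i]) (s : R) :
  holomorphic_upper f ->
  open [set p : R * R | 0 < p.2 /\ s < cmod (f (Complex p.1 p.2))].
Proof.
move=> hf; rewrite openE => -[x y] [/= y0 sf].
have : {for (Complex x y), continuous (f : R[i]^o -> R[i]^o)}.
  by apply: differentiable_continuous; apply/derivable1_diffP; exact: hf.
move=> /cvgrPdist_lt /(_ (cmod (f (Complex x y)) - s)%:C%C).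
rewrite ltcR subr_gt0 => /(_ sf).
move=> /nbhs_ballP[[d di] /= d0 dball].
(* The radius is a complex number; being positive in the order of [R[i]], it has imaginary part
   0. *)
move: d0; rewrite ltcE/= => /andP[/eqP di0 d0]; rewrite {}di0 in dball.
(* The bound [y] keeps the square in the upper half-plane; [d / 2] per coordinate keeps the modulus
   of the difference below [d]. *)
pose e := Num.min y (d / 2).
have ey : e <= y by rewrite ge_min lexx.
have ed : e <= d / 2 by rewrite ge_min lexx orbT.
have e0 : 0 < e by rewrite lt_min y0 divr_gt0.
rewrite /interior -nbhs_ballE; exists e => //.
move=> [a b] [/= xa yb]; rewrite /ball/= in xa yb.
split => /=; first by move: yb; rewrite ltr_norml => /andP[]; lra.
have : ball (Complex x y : R[i]^o) (Complex d 0) (Complex a b).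
  rewrite /ball/= normc_cmod ltcR (le_lt_trans (cmod_le _))//=.
  by rewrite [ltRHS](splitr d) ltrD//; lra.
move=> /dball /=; rewrite normc_cmod ltcR.
by move/(le_lt_trans (cmodB_ge _ _)); lra.
Qed.

(** * The test function adapted to an interval *)

Lemma derivable_square_inverse (K : numFieldType) (u l c z : K) : z - c != 0 ->
  derivable (fun w : K^o => u * (l * (w - c)^-1) ^+ 2 : K^o) z 1.
Proof.
move=> zc; apply: derivableM; first exact: derivable_cst.
apply: (@derivableX K K^o (fun w => l * (w - c)^-1) 2).
apply: derivableM; first exact: derivable_cst.
by apply: derivableV.
Qed.

Section test_function.
Variables (R : realType) (u a L : R).
Hypotheses (u0 : 0 < u) (L0 : 0 < L).

(** The pole [a - iL] lies below the real line, and squaring the kernel makes it integrable on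
    horizontal lines. *)
Definition bump (z : R[i]) : R[i] :=
  u%:C%C * (L%:C%C * (z - Complex a (- L))^-1) ^+ 2.

Lemma cmod_bump (x y : R) :
  cmod (bump (Complex x y)) = u * L ^+ 2 / ((x - a) ^+ 2 + (y + L) ^+ 2).
Proof.
rewrite /bump expr2 !cmodM cmodV !cmod_real ?ltW//.
have -> : (Complex x y - Complex a (- L)) = Complex (x - a) (y + L).
  by rewrite -[in RHS](opprK L).
rewrite -[RHS]mulrA; congr (_ * _); rewrite mulrACA -!expr2; congr (_ * _).
by rewrite exprVn sqr_sqrtr// addr_ge0// sqr_ge0.
Qed.

Lemma holomorphic_bump : holomorphic_upper bump.
Proof.
move=> z z0; have zaL : z - Complex a (- L) != 0.
  case: z z0 => x y /= y0; rewrite subr_eq0; apply/eqP => -[_ yL].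
  by rewrite yL oppr_gt0 ltNge (ltW L0) in y0.
exact: (@derivable_square_inverse R[i] u%:C%C L%:C%C _ z zaL).
Qed.

(** Here the denominator of the modulus is at most [L ^+ 2 + (2 * L) ^+ 2], which is where 5 comes
    from. *)
Lemma bump_box (x y : R) : `|x - a| <= L -> 0 < y < L ->
  u / 5 <= cmod (bump (Complex x y)).
Proof.
move=> xaL /andP[y0 yL]; rewrite cmod_bump -mulrA ler_pM2l//.
have xa2 : (x - a) ^+ 2 <= L ^+ 2.
  by rewrite -(real_normK (num_real (x - a))) lerXn2r ?nnegrE// ltW.
have yL2 : (y + L) ^+ 2 <= (2 * L) ^+ 2.
  by rewrite lerXn2r ?nnegrE//; lra.
have D0 : 0 < (x - a) ^+ 2 + (y + L) ^+ 2.
  by rewrite ltr_wpDl ?sqr_ge0// exprn_gt0// addr_gt0.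
by rewrite ler_pdivlMr//; lra.
Qed.

Lemma ntmax_bump_le (x : R) :
  (ntmax bump x <= (2 * u / (1 + ((x - a) / L) ^+ 2))%:E)%E.
Proof.
apply: ge_ereal_sup => _ [[t y] /= txy <-]; rewrite lee_fin cmod_bump.
have y0 : 0 < y by exact: le_lt_trans txy.
have D0 : 0 < (t - a) ^+ 2 + (y + L) ^+ 2.
  by rewrite ltr_wpDl ?sqr_ge0// exprn_gt0// addr_gt0.
have L2 : 0 < L ^+ 2 by rewrite exprn_gt0.
have -> : 2 * u / (1 + ((x - a) / L) ^+ 2) =
          2 * u * L ^+ 2 / (L ^+ 2 + (x - a) ^+ 2).
  have : L ^+ 2 + (x - a) ^+ 2 != 0 by rewrite gt_eqF// ltr_wpDr ?sqr_ge0.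
  by move=> h; field; rewrite (gt_eqF L0) -?expr2 h.
have D1 : 0 < L ^+ 2 + (x - a) ^+ 2 by rewrite ltr_wpDr ?sqr_ge0.
have ty2 : (t - x) ^+ 2 <= y ^+ 2.
  by rewrite -(real_normK (num_real (t - x))) lerXn2r ?nnegrE// ltW.
(* This square is [2 (t - a)^2 + 2 (t - x)^2 - (x - a)^2]. With [|t - x| < y] it bounds
   [L^2 + (x - a)^2] by twice the denominator at [(t, y)]. *)
have tx2 := sqr_ge0 (2 * t - x - a).
have yL0 : 0 <= y * L by rewrite mulr_ge0 ?ltW.
have L20 := ltW L2.
rewrite ler_pdivrMr//.
rewrite [leRHS](_ : _ = u * L ^+ 2 *
    (2 * ((t - a) ^+ 2 + (y + L) ^+ 2) / (L ^+ 2 + (x - a) ^+ 2))); last by ring.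
apply: ler_peMr; first by rewrite mulr_ge0 ?(ltW u0) ?(ltW L2).
by rewrite ler_pdivlMr//; lra.
Qed.

End test_function.

(** * The integral of [1 / (1 + x^2)] and its affine rescaling *)

Lemma integral_oneDsqrV (R : realType) :
  (\int[lebesgue_measure]_x ((oneDsqr x)^-1)%:E = (pi : R)%:E)%E.
Proof.
rewrite ge0_symfun_integralT//=.
- rewrite (_ : [set x | _] = `[0, +oo[%classic); last first.
    by apply/seteqP; split => x/=; rewrite in_itv/= andbT.
  by rewrite integral0y_oneDsqr -EFinM mulrCA divff// mulr1.
- by move=> x; exact: (@continuous_oneDsqrV R x).
- by move=> x /=; rewrite /oneDsqr sqrrN.
Qed.

Lemma continuous_affine_oneDsqrV (R : realType) (a L : R) :
  continuous (fun x : R => (oneDsqr ((x - a) / L))^-1).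
Proof.
have cF : continuous (fun x : R => (x - a) / L).
  move=> x; apply: (@continuousM _ _ (fun x : R => x - a) (cst L^-1)).
    by apply: (@continuousB _ _ _ id (cst a)); [exact: cvg_id|exact: cst_continuous].
  exact: cst_continuous.
by move=> x; exact: (continuous_comp (cF x) (@continuous_oneDsqrV R _)).
Qed.

(** Substituting [F] in the integral equal to [pi] brings in the derivative [L^-1], which the factor
    [L] cancels. *)
Lemma integral_affine_oneDsqrV (R : realType) (a L : R) : 0 < L ->
  (\int[lebesgue_measure]_x ((oneDsqr ((x - a) / L))^-1)%:E = (L * pi)%:E)%E.
Proof.
move=> L0; pose F x : R := (x - a) / L.
have dF x : is_derive x (1 : R) F L^-1.
  rewrite /F; apply: is_derive_eq.
  by rewrite scaler0 add0r subr0 /GRing.scale/= mulr1.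
have F'E : F^`() = cst L^-1.
  by apply/funext => x; rewrite derive1E; exact: derive_val.
have Li0 : 0 < L^-1 by rewrite invr_gt0.
have cV : continuous (fun x : R => (oneDsqr x)^-1).
  by move=> x; exact: (@continuous_oneDsqrV R x).
have := @increasing_ge0_integration_by_substitutionT R F (fun x => (oneDsqr x)^-1).
rewrite integral_oneDsqrV F'E EFinM => ->.
- rewrite -ge0_integralZl_EFin//=.
  + by apply: eq_integral => x _; rewrite -EFinM mulrCA divff ?mulr1 ?gt_eqF.
  + by move=> x _; rewrite lee_fin mulr_ge0// ?invr_ge0 ltW.
  + apply/measurable_EFinP; apply: measurable_funM => //.
    apply: continuous_measurable_fun; exact: continuous_affine_oneDsqrV.
  + exact: ltW.
- by move=> x y xy; rewrite ltr_pM2r// ltrD2r.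
- by move=> x; exact: cst_continuous.
- exact: is_cvg_cst.
- exact: is_cvg_cst.
- by move=> x; exact: ex_derive.
- by apply: gt0_cvgMlNy => //; exact: cvg_addrr_Ny.
- by apply: gt0_cvgMly => //; exact: cvg_addrr.
- exact: cV.
- by move=> x; rewrite invr_ge0 (le_trans ler01)// oneDsqr_ge1.
Qed.

(** * The two implications between Carleson bound and weak-type estimate *)

Section carleson.
Variables (R : realType) (Phi1 Phi2 : R -> R).
Variable mu : {measure set (R * R)%type -> \bar R}.
Hypotheses (gPhi1 : growth_function Phi1) (gPhi2 : growth_function Phi2).
Hypotheses (cPhi1 : convex_nonneg Phi1) (cPhi2 : convex_nonneg Phi2).
Hypothesis Phi1_gt0 : forall t, 0 < t -> 0 < Phi1 t.
Hypothesis Phi2_gt0 : forall t, 0 < t -> 0 < Phi2 t.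

(** The factor 2 leaves room for an admissible [l'] below twice the norm; the factor [Num.max 1 C1]
    absorbs [C1] at the end through convexity of [Phi2]. *)
Lemma carleson_weak_type (C1 : R) (f : R[i] -> R[i]) (l : R) :
  {in `]0, +oo[ &, {homo (fun t => Phi2 t / Phi1 t) : x y / x <= y}} ->
  0 < C1 ->
  (forall (a b : R) (I : set R), a < b -> `]a, b[ `<=` I -> I `<=` `[a, b] ->
    (mu (Qbox I (b - a)) <= (C1 / Phi2 (ginv Phi1 (1 / (b - a))))%R%:E)%E) ->
  holomorphic_upper f -> (exists z : R[i], 0 < cim z /\ f z != 0) -> 0 < l ->
  ((Phi2 l)%:E * mu [set p : R * R | (0 < p.2)%R /\
      ((2 * Num.max 1 C1 * l)%R%:E * luxnorm Phi1 (ntmax f)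
         < (cmod (f (Complex p.1 p.2)))%:E)%E] <= 1)%E.
Proof.
move=> Phi21 C10 muQ hf [[x y] [/= y0 fz0]] l0.
set C := Num.max 1 C1; set N := luxnorm Phi1 (ntmax f).
have C1' : 1 <= C by rewrite le_max lexx.
have C0 : 0 < C by exact: lt_le_trans C1'.
(* On the base of the tent at a point where [f] is nonzero, [ntmax f] is at least the modulus
   there. *)
have N0 : (0 < N)%E.
  have cmod0 : 0 < cmod (f (Complex x y)).
    have : 0 < `|f (Complex x y)| by rewrite normr_gt0.
    by rewrite normc_cmod ltcR.
  apply: (@luxnorm_gt0 _ _ gPhi1 _ (x - y) (x + y) _ _ cmod0).
  - by lra.
  - exact: ntmax_ge0.
  - move=> t /=; rewrite in_itv/= => /andP[xt tx]; apply: le_ntmax.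
    by rewrite ltr_norml; apply/andP; split; lra.
move: N0; case NE : N => [r| |]// r0; last first.
  (* An infinite norm makes the threshold infinite and the level set empty. *)
  rewrite (_ : [set p | _] = set0) ?measure0 ?mule0//.
  rewrite -subset0 => p [_].
  have Cl0 : (0 < (2 * C * l)%:E)%E by rewrite lte_fin !mulr_gt0.
  by rewrite gt0_muley// ltNge leey.
rewrite lte_fin in r0.
have [l' [l'0 l'r Fl']] : exists l' : R, [/\ 0 < l', (l'%:E < (2 * r)%:E)%E &
    (\int[lebesgue_measure]_x ePhi Phi1 (ntmax f x * (l'^-1)%:E) <= 1)%E].
  by apply: luxnorm_ltP; rewrite -/N NE lte_fin; lra.
rewrite lte_fin in l'r.
pose s := 2 * C * l * r; pose v := C * l.
have v0 : 0 < v by exact: mulr_gt0.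
have s0 : 0 < s by rewrite !mulr_gt0.
have Pv0 := Phi1_gt0 v0; have P2v0 := Phi2_gt0 v0; have Pl0 := Phi2_gt0 l0.
pose E := [set t | (s%:E < ntmax f t)%E].
have oE : open E by exact: open_ntmax_gt.
have mE : measurable E by exact: open_measurable.
have vsl' : v <= s / l'.
  rewrite ler_pdivlMr// (_ : s = v * (2 * r)); last by rewrite /s /v; ring.
  by rewrite ler_pM2l// ltW.
have PE : ((Phi1 v)%:E * lebesgue_measure E <= 1)%E.
  apply: le_trans
    (modular_chebyshev gPhi1 mE (ltW s0) l'0 (ntmax_ge0 f) _ Fl').
    by rewrite lee_wpmul2r// lee_fin growth_le// ltW.
  by move=> t /ltW.
have Ev : (lebesgue_measure E <= ((Phi1 v)^-1)%:E)%E.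
  by rewrite -[leRHS]mule1 lee_pdivlMl.
(* [K] bounds the mass per unit length of boxes over intervals no longer than [E]; then
   [K / Phi1 v = C1 / Phi2 v]. *)
pose K := C1 * Phi1 v / Phi2 v.
have K0 : 0 <= K by rewrite divr_ge0 ?mulr_ge0 ?ltW.
set S := [set p | _].
have SE : S = [set p : R * R | 0 < p.2 /\ s < cmod (f (Complex p.1 p.2))].
  by rewrite /S; apply/seteqP; split => p [p0]; rewrite /= -EFinM lte_fin.
have muS : (mu S <= K%:E * lebesgue_measure E)%E.
  apply: measure_tents_le => //.
  - by apply: le_lt_trans Ev _; exact: ltry.
  - move=> a b I ab abI Iab bE; apply: (le_trans (muQ _ _ _ ab abI Iab)).
    have ba : 0 < b - a by rewrite subr_gt0.
    have iba : 0 < 1 / (b - a) by rewrite divr_gt0.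
    have [u0 Pu] := ginvP gPhi1 cPhi1 Phi1_gt0 iba.
    set u := ginv _ _ in u0 Pu *.
    (* The length [b - a] is at most [1 / Phi1 v], while [Phi1 u = 1 / (b - a)]. Monotonicity of the
       ratio then yields [Phi2 v / Phi1 v <= Phi2 u * (b - a)]. *)
    have vu : v <= u.
      apply: (convex_growth_le_reflect gPhi1 cPhi1 Phi1_gt0 (ltW v0) (ltW u0)).
      have := le_trans bE Ev; rewrite lee_fin Pu => h.
      by rewrite ler_pdivlMr// mulrC -ler_pdivlMr// mul1r.
    have := Phi21 _ _ _ _ vu; rewrite !inE/= !in_itv/= !andbT => /(_ v0 u0).
    rewrite Pu div1r invrK => Pvu.
    have P2u0 := Phi2_gt0 u0.
    rewrite lee_fin /K -!mulrA ler_pM2l//.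
    rewrite -[leLHS]mul1r ler_pdivrMr//.
    rewrite [leRHS](_ : _ = (Phi2 u * (b - a)) / (Phi2 v / Phi1 v)); last first.
      by field; rewrite !gt_eqF.
    by rewrite ler_pdivlMr ?divr_gt0// mul1r.
  - by rewrite SE; apply: open_measurable_prod; exact: holomorphic_open_level.
  - move=> p; rewrite SE => -[p0 sp]; split=> // t /=; rewrite in_itv/= => /andP[pt tp].
    apply: (@lt_le_trans _ _ (cmod (f (Complex p.1 p.2)))%:E); first by rewrite lte_fin.
    by apply: le_ntmax; rewrite ltr_norml; apply/andP; split; lra.
apply: (@le_trans _ _ ((Phi2 l)%:E * (K%:E * lebesgue_measure E))%E).
  by rewrite lee_wpmul2l// lee_fin ltW.
apply: (@le_trans _ _ ((Phi2 l)%:E * (K%:E * ((Phi1 v)^-1)%:E))%E).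
  by rewrite !lee_wpmul2l// lee_fin ltW.
rewrite -!EFinM lee_fin.
rewrite [leLHS](_ : _ = C1 * Phi2 l / Phi2 v); last first.
  by rewrite /K; field; rewrite !gt_eqF.
rewrite ler_pdivrMr// mul1r.
have : Phi2 l <= C^-1 * Phi2 v.
  have -> : l = C^-1 * v by rewrite /v mulKf// gt_eqF.
  apply: convex_growth_contract => //; last by rewrite ltW.
  by rewrite invr_ge0 (ltW C0) invf_le1.
rewrite mulrC ler_pdivlMr// => /(le_trans _); apply.
by rewrite mulrC ler_pM2l// le_max lexx orbT.
Qed.

(** With [w = 1 / (1 + ((x - a) / L)^2)], dividing by [2 * pi] leaves at most [(w / pi) * u];
    convexity bounds its image under [Phi1] by [w / (pi * L)], whose integral is 1. A general [F]
    covers both [ntmax] and the horizontal slices of the bump. *)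
Lemma bump_luxnorm_le (a L : R) (F : R -> \bar R) : 0 < L ->
  (forall x, 0 <= F x)%E ->
  (forall x, F x <= ntmax (bump (ginv Phi1 (1 / L)) a L) x)%E ->
  (luxnorm Phi1 F <= (2 * pi)%:E)%E.
Proof.
move=> L0 F0 Fbump; have iL : 0 < 1 / L by rewrite divr_gt0.
have [u0 Pu] := ginvP gPhi1 cPhi1 Phi1_gt0 iL.
set u := ginv _ _ in u0 Pu Fbump.
have pi0 : 0 < pi :> R by exact: pi_gt0.
have pi2 : 0 < 2 * pi :> R by exact: mulr_gt0.
have pi_ge2 := pi_ge2 R.
apply: luxnorm_le => //.
have w1 x : 0 <= ((oneDsqr ((x - a) / L))^-1 : R) <= 1.
  by rewrite invr_ge0 oneDsqrV_le1 andbT (le_trans ler01)// oneDsqr_ge1.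
have c0 : 0 <= 1 / (L * pi) :> R by rewrite divr_ge0// mulr_ge0 ?pi_ge0// ltW.
apply: (@le_trans _ _
    (\int[lebesgue_measure]_x
       ((1 / (L * pi))%:E * ((oneDsqr ((x - a) / L))^-1)%:E))%E).
  apply: le_ge0_integral_nonmeasurable => x.
    by apply: ePhi_ge0 => //; rewrite mule_ge0// lee_fin invr_ge0 ltW.
  have /andP[w0 w1x] := w1 x; set w := _^-1 in w0 w1x *.
  apply: (@le_trans _ _ (ePhi Phi1 (w / pi * u)%:E)).
    apply: le_ePhi => //; first by rewrite mule_ge0// lee_fin invr_ge0 ltW.
    rewrite (_ : (w / pi * u)%:E = ((2 * u * w)%:E * ((2 * pi)^-1)%:E)%E); last first.
      rewrite -EFinM; congr EFin; move: (pi : R) pi0 => P P0.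
      by field; rewrite gt_eqF.
    rewrite lee_wpmul2r ?lee_fin ?invr_ge0 ?(ltW pi2)//.
    exact: (le_trans (Fbump x) (ntmax_bump_le _ u0 L0 x)).
  rewrite -EFinM lee_fin.
  have wpi : 0 <= w / pi <= 1.
    by rewrite divr_ge0 ?(ltW pi0)//= ler_pdivrMr//; lra.
  apply: le_trans (convex_growth_contract gPhi1 cPhi1 wpi (ltW u0)) _.
  rewrite Pu le_eqVlt; apply/orP; left; apply/eqP; move: (pi : R) pi0 => P P0.
  by field; rewrite !gt_eqF.
rewrite ge0_integralZl_EFin//.
- by rewrite integral_affine_oneDsqrV// -EFinM divfK// gt_eqF// mulr_gt0.
- apply/measurable_EFinP; apply: continuous_measurable_fun.
  exact: continuous_affine_oneDsqrV.
Qed.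

(** At level [l = u / M] the threshold is at most [2 * pi * C2 * u / M <= u / 6], strictly below the
    lower bound [u / 5] on the box. So the box has mass at most [1 / Phi2 l], and the growth bound
    gives [Phi2 u <= C * M^q * Phi2 l]. *)
Lemma weak_type_carleson (q C C2 : R) (a b : R) (I : set R) :
  0 < C ->
  (forall s t, 0 < s -> 1 <= t -> Phi2 (s * t) <= C * t `^ q * Phi2 s) ->
  0 < C2 ->
  (forall f : R[i] -> R[i], hardy_orlicz Phi1 f ->
    (exists z : R[i], 0 < cim z /\ f z != 0) -> forall l, 0 < l ->
    ((Phi2 l)%:E * mu [set p : R * R | (0 < p.2)%R /\
      ((C2 * l)%R%:E * luxnorm Phi1 (ntmax f)
         < (cmod (f (Complex p.1 p.2)))%:E)%E] <= 1)%E) ->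
  a < b -> `]a, b[ `<=` I -> I `<=` `[a, b] ->
  (mu (Qbox I (b - a)) <=
    (C * (Num.max 1 (12 * pi * C2)) `^ q
       / Phi2 (ginv Phi1 (1 / (b - a))))%R%:E)%E.
Proof.
move=> C0 PhiC C20 weak ab abI Iab; set M := Num.max _ _.
have pi0 : 0 < pi :> R by exact: pi_gt0.
pose L := b - a; have L0 : 0 < L by rewrite subr_gt0.
have iL : 0 < 1 / L by rewrite divr_gt0.
have [u0 Pu] := ginvP gPhi1 cPhi1 Phi1_gt0 iL.
rewrite -/L; pose f := bump (ginv Phi1 (1 / L)) a L.
have fN : (luxnorm Phi1 (ntmax f) <= (2 * pi)%:E)%E.
  by apply: (bump_luxnorm_le (a := a) L0) => x; [exact: ntmax_ge0|exact: lexx].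
set u := ginv _ _ in u0 Pu f fN *.
have hf : holomorphic_upper f by exact: holomorphic_bump.
have f0 : exists z : R[i], 0 < cim z /\ f z != 0.
  exists (Complex a (L / 2)) => /=; split; first by rewrite divr_gt0.
  have : u / 5 <= cmod (f (Complex a (L / 2))).
    apply: bump_box => //; first by rewrite subrr normr0 ltW.
    by apply/andP; split; lra.
  apply: contraTneq => ->; rewrite -ltNge /cmod/= expr0n/= addr0 sqrtr0.
  by rewrite divr_gt0.
have Hf : hardy_orlicz Phi1 f.
  split=> //; exists (2 * pi) => y y0; apply: (bump_luxnorm_le (a := a) L0) => x.
    by rewrite lee_fin sqrtr_ge0.
  by apply: le_ntmax; rewrite subrr normr0.
have M1 : 1 <= M by rewrite le_max lexx.
have M0 : 0 < M by exact: lt_le_trans M1.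
have MC2 : 12 * pi * C2 <= M by rewrite le_max lexx orbT.
pose l := u / M; have l0 : 0 < l by rewrite divr_gt0.
have := weak f Hf f0 l l0; set S := [set p | _] => muS.
(* The norm is finite, so the threshold is a real number and the level set is open. *)
have oS : S = [set p : R * R | 0 < p.2 /\
    fine ((C2 * l)%:E * luxnorm Phi1 (ntmax f)) < cmod (f (Complex p.1 p.2))].
  have N0 : (0 <= luxnorm Phi1 (ntmax f))%E.
    by apply: le_ereal_inf_tmp => _ [r [r0 _] <-]; rewrite lee_fin ltW.
  have Nfin : ((C2 * l)%:E * luxnorm Phi1 (ntmax f))%E \is a fin_num.
    rewrite fin_numM// ge0_fin_numE//.
    by rewrite (le_lt_trans fN)// ltry.
  by rewrite /S; apply/seteqP; split => p [p0]; rewrite /= -lte_fin fineK.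
have mS : measurable S.
  by rewrite oS; apply: open_measurable_prod; exact: holomorphic_open_level.
have QS : Qbox I (b - a) `<=` S.
  move=> [x y] [/= Ix /andP[y0 yL]]; split => //=.
  apply: (@le_lt_trans _ _ (u / 6)%:E).
    apply: (@le_trans _ _ ((C2 * l)%:E * (2 * pi)%:E)%E).
      by rewrite lee_wpmul2l// lee_fin ltW// mulr_gt0.
    rewrite -EFinM lee_fin.
    rewrite [leLHS](_ : _ = (u / 6) * ((12 * pi * C2) / M)); last first.
      by rewrite /l; clearbody M; move: (pi : R) => P; field; rewrite gt_eqF.
    by rewrite ler_piMr ?divr_ge0 ?(ltW u0)// ler_pdivrMr// mul1r.
  rewrite lte_fin; apply: (@lt_le_trans _ _ (u / 5)); first by lra.
  apply: bump_box => //; last by rewrite y0.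
  have := Iab _ Ix; rewrite /= in_itv/= => /andP[ax xb].
  by rewrite ger0_norm ?subr_ge0// lerD2r.
(* Only endpoints can be missing from [I], so it is order-convex. *)
have mI : measurable I.
  apply: is_interval_measurable => c d Ic Id e /andP[ce ed].
  have [<-//|nce] := eqVneq c e; have [->//|ned] := eqVneq e d.
  have := Iab _ Ic; have := Iab _ Id; rewrite /= !in_itv/= => /andP[_ db] /andP[ac _].
  apply: abI; rewrite /= in_itv/=; apply/andP; split.
    by apply: (le_lt_trans ac); rewrite lt_neqAle nce.
  by apply: lt_le_trans db; rewrite lt_neqAle ned.
apply: (@le_trans _ _ (mu S)).
  by apply: le_measure; rewrite ?inE//; exact: measurable_Qbox.
have Pl0 := Phi2_gt0 l0; have P2u0 := Phi2_gt0 u0.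
apply: (@le_trans _ _ ((Phi2 l)^-1)%:E).
  by rewrite -[leRHS]mule1 lee_pdivlMl.
rewrite lee_fin -[leLHS]mul1r ler_pdivrMr// mulrAC ler_pdivlMr// mul1r.
have := PhiC l M l0 M1; by rewrite divfK// gt_eqF.
Qed.

End carleson.

(** Sets between []a, b[] and [[a, b]] are the bounded nondegenerate intervals of every endpoint
    type. Nonvanishing of [f] is asked in the upper half-plane, as values elsewhere are
    arbitrary. *)
Theorem theorem7p1 (R : realType) (Phi1 Phi2 : R -> R)
    (mu : {measure set (R * R)%type -> \bar R}) :
  growth_function Phi1 -> growth_function Phi2 ->
  convex_nonneg Phi1 -> convex_nonneg Phi2 ->
  C1_nonneg Phi1 -> C1_nonneg Phi2 ->
  in_U Phi2 -> nabla2 Phi1 ->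
  {in `]0, +oo[ &, {homo (fun t => Phi2 t / Phi1 t) : x y / x <= y}} ->
  ((exists C1 : R, 0 < C1 /\
      forall (a b : R) (I : set R), a < b -> `]a, b[ `<=` I -> I `<=` `[a, b] ->
        (mu (Qbox I (b - a)) <= (C1 / Phi2 (ginv Phi1 (1 / (b - a))))%R%:E)%E)
   <->
   (exists C2 : R, 0 < C2 /\
      forall f : R[i] -> R[i], hardy_orlicz Phi1 f ->
        (exists z : R[i], 0 < cim z /\ f z != 0) ->
        (ereal_sup [set ((Phi2 l)%:E *
            mu [set p : R * R | (0 < p.2)%R /\
                 ((C2 * l)%R%:E * luxnorm Phi1 (ntmax f)
                    < (cmod (f (Complex p.1 p.2)))%:E)%E])%E
          | l in [set l : R | (0 < l)%R]] <= 1)%E)).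
Proof.
move=> gPhi1 gPhi2 cPhi1 cPhi2 _ _ [q [q1 UqPhi2]] [D2 _] Phi21.
have Phi1_gt0 t : 0 < t -> 0 < Phi1 t by exact: Delta2_gt0.
have Phi2_gt0 t : 0 < t -> 0 < Phi2 t by exact: Uq_gt0 UqPhi2.
split=> [[C1 [C10 muQ]]|[C2 [C20 weak]]].
  exists (2 * Num.max 1 C1); split; first by rewrite mulr_gt0// lt_max ltr01.
  move=> f [hf _] fz; apply: ge_ereal_sup => _ [l /= l0 <-].
  exact: carleson_weak_type.
have [_ [[C [C0 PhiC]] _]] := UqPhi2.
exists (C * (Num.max 1 (12 * pi * C2)) `^ q); split.
  by rewrite mulr_gt0// powR_gt0// lt_max ltr01.
move=> a b I ab abI Iab; apply: weak_type_carleson => // f Hf fz l l0.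
by apply: le_trans (weak f Hf fz); apply: ereal_sup_ubound; exists l.
Qed.
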